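(* Let $(X,d)$ be a complete multiplicative metric space. Suppose the mapping $f:X\to X$ satisfies $$d(f(x),f(y))\le \bigl(d(f(x),y)\cdot d(f(y),x)\bigr)^{\lambda}\quad\text{for all } x,y\in X,$$ where $\lambda\in[0,\tfrac12)$ is a constant. Then $f$ has a unique fixed point in $X$. Moreover, for any $x\in X$, the sequence of iterates $(f^n(x))$ is multiplicative convergent to the fixed point.
   Context: A multiplicative metric on a nonempty set $X$ is a mapping $d:X\times X\to\mathbb{R}$ such that for all $x,y,z\in X$: (m1) $d(x,y)\ge 1$, and $d(x,y)=1$ if and only if $x=y$; (m2) $d(x,y)=d(y,x)$; (m3) $d(x,z)\le d(x,y)\cdot d(y,z)$. The pair $(X,d)$ is then called a multiplicative metric space. A sequence $(x_n)$ in $X$ is multiplicative convergent to $x\in X$ if for every $\varepsilon>1$ there is $N\in\mathbb{N}$ such that $d(x_n,x)<\varepsilon$ for all $n\ge N$. It is a multiplicative Cauchy sequence if for every $\varepsilon>1$ there is $N\in\mathbb{N}$ such that $d(x_m,x_n)<\varepsilon$ for all $m,n\ge N$. The space $(X,d)$ is complete if every multiplicative Cauchy sequence in $X$ is multiplicative convergent to some $x\in X$. $f^n$ denotes the $n$-fold composition of $f$ with itself. *)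

(* Defs.v *)
From Stdlib Require Import Reals.
Open Scope R_scope.

Record multiplicative_metric {X : Type} (d : X -> X -> R) : Prop := {
  mm_ge1 : forall x y, 1 <= d x y;
  mm_eq1 : forall x y, d x y = 1 <-> x = y;
  mm_sym : forall x y, d x y = d y x;
  mm_tri : forall x y z, d x z <= d x y * d y z
}.

Definition mult_convergent {X : Type} (d : X -> X -> R) (u : nat -> X) (x : X)
  : Prop :=
  forall eps : R, 1 < eps ->
    exists N : nat, forall n : nat, (N <= n)%nat -> d (u n) x < eps.

Definition mult_cauchy {X : Type} (d : X -> X -> R) (u : nat -> X) : Prop :=
  forall eps : R, 1 < eps ->
    exists N : nat, forall m n : nat, (N <= m)%nat -> (N <= n)%nat ->
      d (u m) (u n) < eps.

Definition mult_complete {X : Type} (d : X -> X -> R) : Prop :=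
  forall u : nat -> X, mult_cauchy d u -> exists x : X, mult_convergent d u x.

(* Main.v *)
Require Import Defs.
From Stdlib Require Import Reals.
From Stdlib Require Import Lra Lia.
Open Scope R_scope.

(** The logarithm turns a multiplicative metric [d] into an ordinary metric
    [ln d] and the hypothesis on [f] into Chatterjea's condition
      [dist (f x) (f y) <= lambda * (dist (f x) y + dist (f y) x)],
    so the statement is Chatterjea's fixed point theorem read through [ln].

    Two consequences of that condition carry the argument.  Taking [y := f x]
    kills one of the two terms on the right, and the triangle inequality then
    shows that consecutive iterates approach each other geometrically, with
    ratio [lambda / (1 - lambda) < 1] ([chatterjea_step]).  Comparing
    [dist (f x) y] with [dist (f x) (f y)] instead bounds [dist (f x) (f y)]
    by a multiple of [dist x (f x) + dist y (f y)] ([chatterjea_displacement]);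
    this uses [lambda < 1 / 2].  Together they make every orbit Cauchy without
    summing a geometric series, and the second alone gives uniqueness, since
    fixed points have zero displacement.  The limit of an orbit is fixed
    ([chatterjea_limit_fixed]) by passing to the limit in the condition itself.
    Every orbit thus converges to some fixed point, hence to the only one. *)

(** * Chatterjea maps on metric spaces *)

Definition chatterjea (M : Metric_Space) (f : Base M -> Base M) (lambda : R) :=
  forall x y : Base M,
    dist M (f x) (f y) <= lambda * (dist M (f x) y + dist M (f y) x).

Lemma dist_self (M : Metric_Space) (x : Base M) : dist M x x = 0.
Proof. now apply dist_refl. Qed.

(** With [y := f x] the condition reads [dist (f x) (f (f x)) <=
    lambda * dist (f (f x)) x], and the path through [f x] bounds the right
    side by the two consecutive steps. *)
Lemma chatterjea_step (M : Metric_Space) (f : Base M -> Base M) (lambda : R) :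
  0 <= lambda < 1 -> chatterjea M f lambda ->
  forall x, dist M (f x) (f (f x)) <= lambda / (1 - lambda) * dist M x (f x).
Proof.
  intros Hl Hf x.
  pose proof (Hf x (f x)) as H.
  rewrite dist_self in H.
  pose proof (dist_tri M (f (f x)) x (f x)) as T.
  rewrite (dist_sym M (f (f x)) (f x)), (dist_sym M (f x) x) in T.
  apply Rmult_le_reg_l with (1 - lambda); [lra|].
  replace ((1 - lambda) * (lambda / (1 - lambda) * dist M x (f x)))
    with (lambda * dist M x (f x)) by (field; lra).
  nra.
Qed.

(** Both [dist (f x) y] and [dist (f y) x] exceed [dist (f x) (f y)] by at most
    a displacement, so a share [2 * lambda] of the left side can be absorbed. *)
Lemma chatterjea_displacement (M : Metric_Space) (f : Base M -> Base M)
  (lambda : R) :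
  0 <= lambda -> chatterjea M f lambda ->
  forall x y, (1 - 2 * lambda) * dist M (f x) (f y)
              <= lambda * (dist M x (f x) + dist M y (f y)).
Proof.
  intros Hl Hf x y.
  pose proof (Hf x y) as H.
  pose proof (dist_tri M (f x) y (f y)) as T1.
  pose proof (dist_tri M (f y) x (f x)) as T2.
  rewrite (dist_sym M (f y) y) in T1.
  rewrite (dist_sym M (f y) (f x)), (dist_sym M (f x) x) in T2.
  nra.
Qed.

Lemma chatterjea_fixed_unique (M : Metric_Space) (f : Base M -> Base M)
  (lambda : R) :
  0 <= lambda < 1 / 2 -> chatterjea M f lambda ->
  forall p q, f p = p -> f q = q -> p = q.
Proof.
  intros Hl Hf p q Hp Hq.
  apply (dist_refl M).
  pose proof (chatterjea_displacement M f lambda (proj1 Hl) Hf p q) as H.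
  rewrite Hp, Hq, !dist_self in H.
  pose proof (dist_pos M p q) as P.
  nra.
Qed.

Lemma chatterjea_iter_step (M : Metric_Space) (f : Base M -> Base M)
  (lambda : R) :
  0 <= lambda < 1 -> chatterjea M f lambda ->
  forall x n, dist M (Nat.iter n f x) (Nat.iter (S n) f x)
              <= (lambda / (1 - lambda)) ^ n * dist M x (f x).
Proof.
  intros Hl Hf x n.
  assert (Hh : 0 <= lambda / (1 - lambda)).
  { apply Rmult_le_pos; [lra|].
    left; apply Rinv_0_lt_compat; lra. }
  induction n as [|n IH]; simpl; [lra|].
  eapply Rle_trans; [now apply chatterjea_step with (lambda := lambda)|].
  rewrite Rmult_assoc.
  now apply Rmult_le_compat_l.
Qed.

Lemma chatterjea_asymptotically_regular (M : Metric_Space)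
  (f : Base M -> Base M) (lambda : R) :
  0 <= lambda < 1 / 2 -> chatterjea M f lambda ->
  forall x eps, 0 < eps -> exists N : nat, forall n, (N <= n)%nat ->
    dist M (Nat.iter n f x) (Nat.iter (S n) f x) < eps.
Proof.
  intros Hl Hf x eps He.
  pose proof (dist_pos M x (f x)) as P.
  assert (Hh : 0 <= lambda / (1 - lambda) < 1).
  { split.
    - apply Rmult_le_pos; [lra|].
      left; apply Rinv_0_lt_compat; lra.
    - apply Rmult_lt_reg_r with (1 - lambda); [lra|].
      replace (lambda / (1 - lambda) * (1 - lambda)) with lambda by (field; lra).
      lra. }
  (* The [+ 1] keeps the denominator positive when [x] is already fixed. *)
  destruct (pow_lt_1_zero (lambda / (1 - lambda))
              ltac:(rewrite Rabs_pos_eq; lra)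
              (eps / (dist M x (f x) + 1))) as [N HN].
  { apply Rdiv_lt_0_compat; lra. }
  exists N; intros n Hn.
  specialize (HN n Hn).
  pose proof (pow_le _ n (proj1 Hh)) as Hp.
  rewrite Rabs_pos_eq in HN by exact Hp.
  eapply Rle_lt_trans;
    [apply (chatterjea_iter_step M f lambda); [lra|exact Hf]|].
  apply Rle_lt_trans
    with ((lambda / (1 - lambda)) ^ n * (dist M x (f x) + 1)).
  { apply Rmult_le_compat_l; lra. }
  apply Rmult_lt_compat_r with (r := dist M x (f x) + 1) in HN; [|lra].
  replace (eps / (dist M x (f x) + 1) * (dist M x (f x) + 1))
    with eps in HN by (field; lra).
  exact HN.
Qed.

(** Two late iterates are images of points with small displacement. *)
Lemma chatterjea_orbit_cauchy (M : Metric_Space) (f : Base M -> Base M)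
  (lambda : R) :
  0 <= lambda < 1 / 2 -> chatterjea M f lambda ->
  forall x eps, 0 < eps -> exists N : nat, forall m n,
    (N <= m)%nat -> (N <= n)%nat ->
    dist M (Nat.iter m f x) (Nat.iter n f x) < eps.
Proof.
  intros Hl Hf x eps He.
  destruct (chatterjea_asymptotically_regular M f lambda Hl Hf x
              ((1 - 2 * lambda) * eps)) as [N HN].
  { apply Rmult_lt_0_compat; lra. }
  (* One index is lost because the bound concerns images under [f]. *)
  exists (S N); intros m n Hm Hn.
  destruct m as [|m]; [lia|].
  destruct n as [|n]; [lia|].
  pose proof (HN m ltac:(lia)) as Am.
  pose proof (HN n ltac:(lia)) as An.
  pose proof (chatterjea_displacement M f lambda (proj1 Hl) Hf
                (Nat.iter m f x) (Nat.iter n f x)) as H.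
  simpl in *.
  apply Rmult_lt_reg_l with (1 - 2 * lambda); [lra|].
  pose proof (dist_pos M (Nat.iter m f x) (f (Nat.iter m f x))).
  nra.
Qed.

(** Chatterjea's condition between [p] and a late iterate [u] bounds
    [dist (f p) p] by [lambda * dist (f p) u] up to terms that vanish in the
    limit; [u] being close to [p], a share [lambda < 1] of [dist (f p) p] is
    absorbed. *)
Lemma chatterjea_limit_fixed (M : Metric_Space) (f : Base M -> Base M)
  (lambda : R) :
  0 <= lambda < 1 -> chatterjea M f lambda ->
  forall x p,
    (forall eps, 0 < eps -> exists N : nat, forall n, (N <= n)%nat ->
       dist M (Nat.iter n f x) p < eps) ->
    f p = p.
Proof.
  intros Hl Hf x p Hlim.
  apply (dist_refl M).
  pose proof (dist_pos M (f p) p) as P.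
  destruct (Rle_lt_or_eq_dec 0 (dist M (f p) p)) as [Hpos|]; [lra| |easy].
  exfalso.
  (* The error terms sum to at most [3 * eps], which must stay below
     [(1 - lambda) * dist (f p) p]. *)
  destruct (Hlim ((1 - lambda) * dist M (f p) p / 4)) as [N HN].
  { apply Rdiv_lt_0_compat; [apply Rmult_lt_0_compat|]; lra. }
  pose proof (HN N (le_n N)) as A.
  pose proof (HN (S N) ltac:(lia)) as B.
  simpl in B.
  set (u := Nat.iter N f x) in *.
  pose proof (Hf p u) as H.
  pose proof (dist_tri M (f p) p (f u)) as T1.
  pose proof (dist_tri M (f p) u p) as T2.
  rewrite (dist_sym M p u) in T2.
  pose proof (dist_pos M u p).
  pose proof (dist_pos M (f u) p).
  nra.
Qed.

(** * The logarithm of a multiplicative metric *)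

Lemma mult_metric_pos {X : Type} (d : X -> X -> R) :
  multiplicative_metric d -> forall x y, 0 < d x y.
Proof. intros hd x y; pose proof (mm_ge1 d hd x y); lra. Qed.

Lemma ln_le_compat (x y : R) : 0 < x -> x <= y -> ln x <= ln y.
Proof.
  intros Hx [Hlt|Heq]; [|rewrite Heq; lra].
  left; now apply ln_increasing.
Qed.

Definition log_metric {X : Type} (d : X -> X -> R)
  (hd : multiplicative_metric d) : Metric_Space.
Proof.
  refine (Build_Metric_Space X (fun x y => ln (d x y)) _ _ _ _).
  - intros x y.
    apply Rle_ge; rewrite <- ln_1.
    apply ln_le_compat; [lra|apply (mm_ge1 d hd)].
  - intros x y.
    now rewrite (mm_sym d hd).
  - intros x y; rewrite <- (mm_eq1 d hd), <- ln_1.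
    split; intros H; [|now rewrite H].
    apply ln_inv; [now apply mult_metric_pos|lra|exact H].
  - intros x y z.
    rewrite <- ln_mult by now apply mult_metric_pos.
    apply ln_le_compat; [now apply mult_metric_pos|apply (mm_tri d hd)].
Defined.

Lemma dist_log_metric {X : Type} (d : X -> X -> R)
  (hd : multiplicative_metric d) (x y : X) :
  dist (log_metric d hd) x y = ln (d x y).
Proof. reflexivity. Qed.

Lemma log_cauchy_mult_cauchy {X : Type} (d : X -> X -> R)
  (hd : multiplicative_metric d) (u : nat -> X) :
  (forall eps, 0 < eps -> exists N : nat, forall m n,
     (N <= m)%nat -> (N <= n)%nat ->
     dist (log_metric d hd) (u m) (u n) < eps) ->
  mult_cauchy d u.
Proof.
  intros Hu eps He.
  destruct (Hu (ln eps)) as [N HN].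
  { rewrite <- ln_1; apply ln_increasing; lra. }
  exists N; intros m n Hm Hn.
  apply ln_lt_inv; [now apply mult_metric_pos|lra|].
  now apply HN.
Qed.

Lemma mult_convergent_log {X : Type} (d : X -> X -> R)
  (hd : multiplicative_metric d) (u : nat -> X) (p : X) :
  mult_convergent d u p ->
  forall eps, 0 < eps -> exists N : nat, forall n, (N <= n)%nat ->
    dist (log_metric d hd) (u n) p < eps.
Proof.
  intros Hu eps He.
  destruct (Hu (exp eps)) as [N HN].
  { rewrite <- exp_0; now apply exp_increasing. }
  exists N; intros n Hn.
  rewrite dist_log_metric, <- (ln_exp eps).
  apply ln_increasing; [now apply mult_metric_pos|now apply HN].
Qed.

Lemma log_metric_chatterjea {X : Type} (d : X -> X -> R)
  (hd : multiplicative_metric d) (f : X -> X) (lambda : R) :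
  (forall x y, d (f x) (f y) <= Rpower (d (f x) y * d (f y) x) lambda) ->
  chatterjea (log_metric d hd) f lambda.
Proof.
  intros hf x y.
  rewrite !dist_log_metric.
  rewrite <- ln_mult by now apply mult_metric_pos.
  rewrite <- (ln_exp (lambda * _)).
  apply ln_le_compat; [now apply mult_metric_pos|apply hf].
Qed.

(** * The fixed point theorem *)

Theorem theorem3p6 (X : Type) (hX : inhabited X) (d : X -> X -> R)
  (hd : multiplicative_metric d) (hcomplete : mult_complete d)
  (f : X -> X) (lambda : R) (hlambda : 0 <= lambda < 1 / 2)
  (hf : forall x y : X,
      d (f x) (f y) <= Rpower (d (f x) y * d (f y) x) lambda) :
  exists p : X,
    unique (fun z : X => f z = z) p /\
    forall x : X, mult_convergent d (fun n : nat => Nat.iter n f x) p.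
Proof.
  pose proof (log_metric_chatterjea d hd f lambda hf) as Hc.
  assert (Horbit : forall x, exists p,
             f p = p /\ mult_convergent d (fun n => Nat.iter n f x) p).
  { intros x.
    destruct (hcomplete (fun n => Nat.iter n f x)) as [p Hp].
    { apply (log_cauchy_mult_cauchy d hd).
      exact (chatterjea_orbit_cauchy (log_metric d hd) f lambda hlambda Hc x). }
    exists p; split; [|exact Hp].
    apply (chatterjea_limit_fixed (log_metric d hd) f lambda ltac:(lra) Hc x p).
    exact (mult_convergent_log d hd _ p Hp). }
  pose proof (chatterjea_fixed_unique (log_metric d hd) f lambda hlambda Hc) as Huniq.
  destruct hX as [x0].
  destruct (Horbit x0) as [p [Hp _]].
  exists p; split.
  - split; [exact Hp|].
    intros q Hq; exact (Huniq p q Hp Hq).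
  - intros x.
    destruct (Horbit x) as [q [Hq Hconv]].
    now rewrite (Huniq p q Hp Hq).
Qed.
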